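(* Let $\mathfrak B=(W,\le,R,V)$ and $\mathfrak B'=(W',\le',R',V')$ be two modally saturated birelational models. Then bisimilarity and modal equivalence coincide between these models: for all $w\in W$ and $w'\in W'$, there is an IK-bisimulation between $\mathfrak B$ and $\mathfrak B'$ linking $w$ and $w'$ if and only if $w$ and $w'$ satisfy the same formulas of $\mathcal L_{\Box\Diamond}$.
   Context: Fix a denumerable set $\mathrm{Prop}$ of propositional letters. The modal language $\mathcal L_{\Box\Diamond}$ is generated by $\varphi::=P\mid\bot\mid\varphi\wedge\varphi\mid\varphi\vee\varphi\mid\varphi\to\varphi\mid\Box\varphi\mid\Diamond\varphi$ with $P\in\mathrm{Prop}$. A birelational model is $\mathfrak B=(W,\le,R,V)$ with $(W,\le)$ a poset, $V$ mapping each $P\in\mathrm{Prop}$ to an upset of $(W,\le)$, and $R\subseteq W\times W$ such that: if $w\le v$ and $wRu$ then there is $t$ with $vRt$ and $u\le t$; and if $wRu$ and $u\le v$ then there is $t$ with $w\le t$ and $tRv$. Satisfaction: $\mathfrak B,w\Vdash P$ iff $w\in V(P)$; $\bot$ never; $\wedge,\vee$ pointwise; $\mathfrak B,w\Vdash\varphi\to\psi$ iff for all $v\ge w$, $\mathfrak B,v\Vdash\varphi$ implies $\mathfrak B,v\Vdash\psi$; $\mathfrak B,w\Vdash\Box\varphi$ iff for all $v,u$ with $w\le v$ and $vRu$, $\mathfrak B,u\Vdash\varphi$; $\mathfrak B,w\Vdash\Diamond\varphi$ iff there is $v$ with $wRv$ and $\mathfrak B,v\Vdash\varphi$. Write $w\,(\le;R)\,v$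 if there is $t$ with $w\le t$ and $tRv$. An IK-bisimulation between $\mathfrak B$ and $\mathfrak B'$ is a relation $Z\subseteq W\times W'$ such that for all $(w,w')\in Z$: (i) $w\in V(p)$ iff $w'\in V'(p)$ for all $p\in\mathrm{Prop}$; (ii) if $w\le v$ there is $v'$ with $(v,v')\in Z$ and $w'\le'v'$; (iii) if $w'\le'v'$ there is $v$ with $(v,v')\in Z$ and $w\le v$; (iv) if $wRv$ there is $v'$ with $(v,v')\in Z$ and $w'(\le';R')v'$; (v) if $w'R'v'$ there is $v$ with $(v,v')\in Z$ and $w(\le;R)v$; (vi) if $wRv$ there are $s\in W$, $s'\in W'$ with $v\le s$, $w'R's'$ and $(s,s')\in Z$; (vii) if $w'R'v'$ there are $s'\in W'$, $s\in W$ with $v'\le's'$, $wRs$ and $(s,s')\in Z$. A consecution is a pair $\langle\Phi:\Psi\rangle$ of sets of formulas $\Phi,\Psi\subseteq\mathcal L_{\Box\Diamond}$; a world separates it if it satisfies all formulas in $\Phi$ and satisfies no formula in $\Psi$. It is separable in $X\subseteq W$ if some $w\in X$ separates it, and finitely separable in $X$ if $\langle\Phi':\Psi'\rangle$ is separable in $X$ for all finite $\Phi'\subseteq\Phi$, $\Psi'\subseteq\Psi$. A set $\Phi$ is (finitely) satisfiable in $X$ if $\langle\Phi:\emptyset\rangle$ is (finitely) separable in $X$. A set $X\subseteq W$ is positively saturated if every $\Phi\subseteq\mathcal L_{\Box\Diamond}$ that is finitely satisfiable in $X$ is satisfiable in $X$, and saturated if every consecution that is finitely separable in $X$ is separable in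 $X$. The model $\mathfrak B$ is modally saturated if for each $w\in W$ the set $R[w]=\{v\mid wRv\}$ is positively saturated and the sets ${\uparrow}w=\{v\mid w\le v\}$ and $R_\uparrow[w]=\{v\mid w(\le;R)v\}$ are saturated. *)

(* Defs.v *)
From Stdlib Require Import Relations Ensembles Finite_sets.

Set Implicit Arguments.
Unset Strict Implicit.
Unset Printing Implicit Defensive.

Arguments In {U} A x.
Arguments Included {U} B C.
Arguments Empty_set {U}.
Arguments Finite {U} _.

Definition letter : Type := nat.

Inductive form : Type :=
  | Var (p : letter)
  | Bot
  | And (f g : form)
  | Or (f g : form)
  | Imp (f g : form)
  | Box (f : form)
  | Dia (f : form).

Definition upset (W : Type) (le : relation W) (X : Ensemble W) : Prop :=
  forall w v, In X w -> le w v -> In X v.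

Record birelational_model : Type := BirelationalModel {
  world :> Type;
  le : relation world;
  R : relation world;
  V : letter -> Ensemble world;
  le_order : order world le;
  V_upset : forall p, upset le (V p);
  R_forth_up : forall w v u, le w v -> R w u -> exists t, R v t /\ le u t;
  R_back_up : forall w u v, R w u -> le u v -> exists t, le w t /\ R t v
}.

Arguments le {_} _ _.
Arguments R {_} _ _.
Arguments V {_} _ _.

Fixpoint sat (B : birelational_model) (w : B) (f : form) : Prop :=
  match f with
  | Var p => In (V p) w
  | Bot => False
  | And g h => sat w g /\ sat w h
  | Or g h => sat w g \/ sat w h
  | Imp g h => forall v : B, le w v -> sat v g -> sat v h
  | Box g => forall v u : B, le w v -> R v u -> sat u g
  | Dia g => exists v : B, R w v /\ sat v g
  end.

Definition le_R (B : birelational_model) (w v : B) : Prop :=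
  exists t, le w t /\ R t v.

Record IK_bisimulation (B B' : birelational_model) (Z : B -> B' -> Prop) :
    Prop := IKBisimulation {
  IK_letter : forall w w', Z w w' -> forall p, In (V p) w <-> In (V p) w';
  IK_le_forth : forall w w', Z w w' ->
    forall v, le w v -> exists v', Z v v' /\ le w' v';
  IK_le_back : forall w w', Z w w' ->
    forall v', le w' v' -> exists v, Z v v' /\ le w v;
  IK_box_forth : forall w w', Z w w' ->
    forall v, R w v -> exists v', Z v v' /\ le_R w' v';
  IK_box_back : forall w w', Z w w' ->
    forall v', R w' v' -> exists v, Z v v' /\ le_R w v;
  IK_dia_forth : forall w w', Z w w' ->
    forall v, R w v -> exists s s', le v s /\ R w' s' /\ Z s s';
  IK_dia_back : forall w w', Z w w' ->
    forall v', R w' v' -> exists s' s, le v' s' /\ R w s /\ Z s s'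
}.

Definition modally_equivalent (B B' : birelational_model) (w : B) (w' : B') :
    Prop :=
  forall f, sat w f <-> sat w' f.

(* A consecution is passed around as its two components [Phi] and [Psi]. *)
Definition separates (B : birelational_model) (w : B)
    (Phi Psi : Ensemble form) : Prop :=
  (forall f, In Phi f -> sat w f) /\ (forall f, In Psi f -> ~ sat w f).

Definition separable (B : birelational_model) (X : Ensemble B)
    (Phi Psi : Ensemble form) : Prop :=
  exists w, In X w /\ separates w Phi Psi.

Definition finitely_separable (B : birelational_model) (X : Ensemble B)
    (Phi Psi : Ensemble form) : Prop :=
  forall Phi' Psi' : Ensemble form,
    Finite Phi' -> Included Phi' Phi -> Finite Psi' -> Included Psi' Psi ->
    separable X Phi' Psi'.

Definition satisfiable (B : birelational_model) (X : Ensemble B)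
    (Phi : Ensemble form) : Prop :=
  separable X Phi Empty_set.

Definition finitely_satisfiable (B : birelational_model) (X : Ensemble B)
    (Phi : Ensemble form) : Prop :=
  finitely_separable X Phi Empty_set.

Definition positively_saturated (B : birelational_model) (X : Ensemble B) :
    Prop :=
  forall Phi, finitely_satisfiable X Phi -> satisfiable X Phi.

Definition saturated (B : birelational_model) (X : Ensemble B) : Prop :=
  forall Phi Psi, finitely_separable X Phi Psi -> separable X Phi Psi.

(* As [Ensemble B] is [B -> Prop], the partial applications [R w], [le w] and
   [le_R w] are the sets of successors of [w]. *)
Definition modally_saturated (B : birelational_model) : Prop :=
  forall w : B,
    positively_saturated (R w) /\ saturated (le w) /\ saturated (le_R w).

(* Main.v *)
From Stdlib Require Import Ensembles Finite_sets Relations Classical.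
Require Import Defs.

(** Bisimilar worlds satisfy the same formulas by induction on formulas
    ([bisimulation_preserves_sat]); this direction holds in all models, and
    persistence of truth along the order ([sat_persistent]) absorbs the
    order steps that the diamond clauses insert before the matching pair.

    Conversely, modal equivalence is itself an IK-bisimulation between modally
    saturated models. To match a world [v] by an equivalent world of a saturated
    set [X], one separates the consecution of the formulas true and false at
    [v], so by saturation only finite parts need a separating world in [X]. If
    a finite part [Phi : Psi] had none, then every world of [X] would satisfy
    [C -> D], with [C] the conjunction of [Phi] and [D] the disjunction of
    [Psi]: a failure that the language can state at the other world, as
    [C -> D] for the up-set of that world and as [Box (C -> D)] for its
    [le_R]-successors. Equivalence carries this formula back to a world that
    sees [v], where [v] refutes it. The diamond clause takes two
    steps: negative information cannot be transported along [Dia], so positive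
    saturation first gives only an [R]-successor [s'] satisfying the whole
    theory of [v], and then the implications true at [v] let saturation of the
    up-set of [v] supply a world above [v] equivalent to [s']. *)

(** * Invariance under bisimulation *)

Lemma le_reflexive (B : birelational_model) (w : B) : le w w.
Proof. apply (ord_refl _ _ (le_order B)). Qed.

Lemma le_transitive (B : birelational_model) (u v w : B) :
  le u v -> le v w -> le u w.
Proof. apply (ord_trans _ _ (le_order B)). Qed.

(** For [Dia] this is what the first confluence condition provides; the
    clauses of [Imp] and [Box] have persistence built in. *)
Lemma sat_persistent (B : birelational_model) (f : form) :
  forall w v : B, le w v -> sat w f -> sat v f.
Proof.
  induction f as [p| |g IHg h IHh|g IHg h IHh|g IHg h IHh|g IHg|g IHg];
    simpl; intros w v Hwv Hw.
  - exact (V_upset Hw Hwv).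
  - exact Hw.
  - destruct Hw as [Hg Hh]; eauto.
  - destruct Hw as [Hg|Hh]; eauto.
  - intros u Hvu; apply Hw; exact (le_transitive _ _ _ _ Hwv Hvu).
  - intros u t Hvu; apply Hw; exact (le_transitive _ _ _ _ Hwv Hvu).
  - destruct Hw as [u [Hwu Hu]].
    destruct (R_forth_up Hwv Hwu) as [t [Hvt Hut]].
    exists t; eauto.
Qed.

Lemma IK_bisimulation_converse (B B' : birelational_model)
    (Z : B -> B' -> Prop) :
  IK_bisimulation Z -> IK_bisimulation (fun w' w => Z w w').
Proof.
  intros [Hl Hlf Hlb Hbf Hbb Hdf Hdb]; split; intros w' w Hw; eauto.
  intros p; symmetry; apply Hl; exact Hw.
Qed.

(** The models are quantified inside the induction because implication is
    contravariant: its antecedent is carried along the converse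
    bisimulation. *)
Lemma bisimulation_preserves_sat (f : form) :
  forall (B B' : birelational_model) (Z : B -> B' -> Prop),
    IK_bisimulation Z -> forall w w', Z w w' -> sat w f -> sat w' f.
Proof.
  induction f as [p| |g IHg h IHh|g IHg h IHh|g IHg h IHh|g IHg|g IHg];
    intros B B' Z HZ w w' Hww' Hw; simpl in *.
  - apply (IK_letter HZ Hww'); exact Hw.
  - exact Hw.
  - destruct Hw as [Hg Hh]; eauto.
  - destruct Hw as [Hg|Hh]; eauto.
  - intros v' Hv' Hg.
    destruct (IK_le_back HZ Hww' Hv') as [v [Hvv' Hv]].
    apply (IHh _ _ _ HZ _ _ Hvv'), Hw; [exact Hv|].
    exact (IHg _ _ _ (IK_bisimulation_converse _ _ _ HZ) _ _ Hvv' Hg).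
  - intros v' u' Hv' Hu'.
    destruct (IK_le_back HZ Hww' Hv') as [v [Hvv' Hv]].
    destruct (IK_box_back HZ Hvv' Hu') as [u [Huu' [t [Hvt Htu]]]].
    apply (IHg _ _ _ HZ _ _ Huu'), (Hw t u); [|exact Htu].
    exact (le_transitive _ _ _ _ Hv Hvt).
  - destruct Hw as [v [Hwv Hv]].
    destruct (IK_dia_forth HZ Hww' Hwv) as (s & s' & Hvs & Hs' & Hss').
    exists s'; split; [exact Hs'|].
    apply (IHg _ _ _ HZ _ _ Hss'), (sat_persistent _ _ _ _ Hvs Hv).
Qed.

Lemma modally_equivalent_sym (B B' : birelational_model) (w : B) (w' : B') :
  modally_equivalent w w' -> modally_equivalent w' w.
Proof. intros H f; symmetry; apply H. Qed.

Lemma bisimilar_modally_equivalent (B B' : birelational_model)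
    (Z : B -> B' -> Prop) (w : B) (w' : B') :
  IK_bisimulation Z -> Z w w' -> modally_equivalent w w'.
Proof.
  intros HZ Hww' f; split.
  - exact (bisimulation_preserves_sat f _ _ _ HZ _ _ Hww').
  - exact (bisimulation_preserves_sat f _ _ _
             (IK_bisimulation_converse _ _ _ HZ) _ _ Hww').
Qed.

(** * Finite sets of formulas and saturation *)

Lemma finite_conjunction (Phi : Ensemble form) :
  Finite Phi -> exists c, forall (B : birelational_model) (w : B),
    sat w c <-> (forall f, In Phi f -> sat w f).
Proof.
  intros HPhi; induction HPhi as [|Phi _ [c Hc] g _].
  - exists (Imp Bot Bot); intros B w; split.
    + intros _ f [].
    + intros _ v _ Hv; exact Hv.
  - exists (And c g); intros B w; simpl; rewrite (Hc B w); split.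
    + intros [HPhi Hg] f [f' Hf|f' Hf]; [auto|destruct Hf; exact Hg].
    + intros H; split; [intros f Hf|]; apply H; [left; exact Hf|].
      right; constructor.
Qed.

Lemma finite_disjunction (Psi : Ensemble form) :
  Finite Psi -> exists d, forall (B : birelational_model) (w : B),
    sat w d <-> (exists f, In Psi f /\ sat w f).
Proof.
  intros HPsi; induction HPsi as [|Psi _ [d Hd] g _].
  - exists Bot; intros B w; split.
    + intros [].
    + intros [f [[] _]].
  - exists (Or d g); intros B w; simpl; rewrite (Hd B w); split.
    + intros [[f [Hf Hw]]|Hg].
      * exists f; split; [left; exact Hf|exact Hw].
      * exists g; split; [right; constructor|exact Hg].
    + intros [f [[f' Hf|f' Hf] Hw]]; [left; eauto|].
      right; destruct Hf; exact Hw.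
Qed.

(** A finite part of the theory of [v] that is not separable in [X] would give
    [c] and [d], its conjunction and disjunction, such that [c] implies [d]
    throughout [X] while [v] satisfies [c] but not [d]. The hypothesis on [v]
    is thus finite separability, put in a form that does not mention sets of
    formulas. *)
Lemma saturated_realizes_theory (B B' : birelational_model) (v : B)
    (X : Ensemble B') :
  saturated X ->
  (forall c d, (forall x, In X x -> sat x c -> sat x d) ->
     sat v c -> sat v d) ->
  exists x, In X x /\ modally_equivalent v x.
Proof.
  intros HX Hv.
  destruct (HX (fun f => sat v f) (fun f => ~ sat v f))
    as (x & Hx & Htrue & Hfalse).
  - intros Phi Psi HfPhi HPhi HfPsi HPsi.
    destruct (finite_conjunction Phi HfPhi) as [c Hc].
    destruct (finite_disjunction Psi HfPsi) as [d Hd].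
    apply NNPP; intros Hnsep.
    assert (Hvd : sat v d).
    { apply (Hv c d); [|apply Hc; intros f Hf; exact (HPhi f Hf)].
      intros x Hx Hxc; apply NNPP; intros Hxd.
      apply Hnsep; exists x; split; [exact Hx|split].
      - apply Hc; exact Hxc.
      - intros f Hf Hxf; apply Hxd, Hd; eauto. }
    apply Hd in Hvd; destruct Hvd as [f [Hf Hvf]].
    exact (HPsi f Hf Hvf).
  - exists x; split; [exact Hx|].
    intros f; split; [apply Htrue|].
    intros Hxf; apply NNPP; intros Hvf; exact (Hfalse f Hvf Hxf).
Qed.

(** The implications carry exactly the information that saturation of the
    up-set of [v] asks for: one that holds throughout this up-set is by
    definition a formula true at [v]. *)
Lemma theory_realized_above (B B' : birelational_model) (v : B) (x : B') :
  saturated (le v) ->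
  (forall c d, sat v (Imp c d) -> sat x (Imp c d)) ->
  exists s, le v s /\ modally_equivalent x s.
Proof.
  intros Hsat Hx; apply saturated_realizes_theory; [exact Hsat|].
  intros c d Hcd; exact (Hx c d Hcd x (le_reflexive B' x)).
Qed.

(** * Modal equivalence as a bisimulation *)

Lemma equivalence_le_forth (B B' : birelational_model) (w v : B) (w' : B') :
  saturated (le w') -> modally_equivalent w w' -> le w v ->
  exists v', modally_equivalent v v' /\ le w' v'.
Proof.
  intros Hsat Hww' Hwv.
  destruct (theory_realized_above _ _ w' v Hsat) as [v' [Hv' Hvv']]; eauto.
  intros c d Hcd; apply (sat_persistent _ _ _ _ Hwv), Hww'; exact Hcd.
Qed.

Lemma equivalence_box_forth (B B' : birelational_model) (w v : B) (w' : B') :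
  saturated (le_R w') -> modally_equivalent w w' -> R w v ->
  exists v', modally_equivalent v v' /\ le_R w' v'.
Proof.
  intros Hsat Hww' Hwv.
  destruct (saturated_realizes_theory _ _ v _ Hsat) as [v' [Hv' Hvv']]; eauto.
  intros c d Hcd.
  assert (Hbox : sat w (Box (Imp c d))).
  { apply Hww'; intros t' u' Hwt' Htu' x Hux; apply Hcd.
    (* The second confluence condition makes the [le_R]-successors an up-set,
       so the implication is also tested only at [le_R]-successors. *)
    destruct (R_back_up Htu' Hux) as [y [Hty Hyx]].
    exists y; split; [exact (le_transitive _ _ _ _ Hwt' Hty)|exact Hyx]. }
  exact (Hbox w v (le_reflexive B w) Hwv v (le_reflexive B v)).
Qed.

Lemma equivalence_dia_forth (B B' : birelational_model) (w v : B) (w' : B') :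
  saturated (le v) -> positively_saturated (R w') ->
  modally_equivalent w w' -> R w v ->
  exists s s', le v s /\ R w' s' /\ modally_equivalent s s'.
Proof.
  intros Hsat Hpos Hww' Hwv.
  destruct (Hpos (fun f => sat v f)) as (s' & Hs' & Htrue & _).
  - intros Phi Psi HfPhi HPhi _ HPsi.
    destruct (finite_conjunction Phi HfPhi) as [c Hc].
    assert (Hdia : sat w' (Dia c)).
    { apply Hww'; exists v; split; [exact Hwv|].
      apply Hc; intros f Hf; exact (HPhi f Hf). }
    destruct Hdia as [u' [Hu' Hu'c]].
    exists u'; split; [exact Hu'|split].
    + apply Hc; exact Hu'c.
    + intros f Hf; destruct (HPsi f Hf).
  - destruct (theory_realized_above _ _ v s' Hsat) as [s [Hvs Hss']].
    + intros c d; exact (Htrue (Imp c d)).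
    + exists s, s'; auto using modally_equivalent_sym.
Qed.

Lemma modal_equivalence_IK_bisimulation (B B' : birelational_model) :
  modally_saturated B -> modally_saturated B' ->
  IK_bisimulation (@modally_equivalent B B').
Proof.
  intros HB HB'; split; intros w w' Hww';
    pose proof (modally_equivalent_sym _ _ _ _ Hww') as Hw'w.
  - intros p; exact (Hww' (Var p)).
  - intros v Hv; apply (equivalence_le_forth _ _ w); auto; apply HB'.
  - intros v' Hv'.
    destruct (equivalence_le_forth _ _ w' v' w) as [v [Hvv Hv]]; auto;
      [apply HB|].
    exists v; auto using modally_equivalent_sym.
  - intros v Hv; apply (equivalence_box_forth _ _ w); auto; apply HB'.
  - intros v' Hv'.
    destruct (equivalence_box_forth _ _ w' v' w) as [v [Hvv Hv]]; auto;
      [apply HB|].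
    exists v; auto using modally_equivalent_sym.
  - intros v Hv; apply (equivalence_dia_forth _ _ w); auto;
      [apply HB|apply HB'].
  - intros v' Hv'.
    destruct (equivalence_dia_forth _ _ w' v' w) as (s' & s & Hs' & Hs & Hss);
      auto; [apply HB'|apply HB|].
    exists s', s; auto using modally_equivalent_sym.
Qed.

Theorem theorem4p6 :
  forall B B' : birelational_model,
    modally_saturated B -> modally_saturated B' ->
    forall (w : B) (w' : B'),
      (exists Z : B -> B' -> Prop, IK_bisimulation Z /\ Z w w') <->
      modally_equivalent w w'.
Proof.
  intros B B' HB HB' w w'; split.
  - intros [Z [HZ Hww']]; exact (bisimilar_modally_equivalent _ _ Z w w' HZ Hww').
  - intros Hww'; exists (@modally_equivalent B B'); split; [|exact Hww'].
    exact (modal_equivalence_IK_bisimulation B B' HB HB').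
Qed.
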